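(* Let $T$ be a (finite) tree and let $r \ge 1$ be an integer. Then the $r$-independence complex $\mathrm{Ind}_r(T)$ is vertex decomposable.
   Context: Graphs are finite and simple. For a graph $G$ and $A\subseteq V(G)$, $G[A]$ denotes the induced subgraph on $A$. A tree is a connected graph in which there is a unique path between every pair of distinct vertices. For an integer $r\ge 1$, a subset $A\subseteq V(G)$ is $r$-independent if every connected component of $G[A]$ has at most $r$ vertices. The $r$-independence complex $\mathrm{Ind}_r(G)$ is the simplicial complex whose faces are all $r$-independent subsets of $V(G)$. A simplicial complex $\Delta$ on a finite vertex set is a collection of subsets (faces) closed under taking subsets; facets are the inclusion-maximal faces. The empty complex $\{\emptyset\}$ has only the empty face, and the void complex $\emptyset$ has no faces. A simplex is a complex with exactly one facet (all subsets of a finite set). For a vertex $v$ of $\Delta$: $\mathrm{lk}_\Delta(v)=\{F\in\Delta : v\notin F,\ F\cup\{v\}\in\Delta\}$ and $\mathrm{del}_\Delta(v)=\{F\in\Delta : v\notin F\}$. $\Delta$ is vertex decomposable if either $\Delta$ is a simplex (including the cases $\emptyset$ and $\{\emptyset\}$), or there exists a vertex $v$ of $\Delta$ such that both $\mathrm{lk}_\Delta(v)$ and $\mathrm{del}_\Delta(v)$ are vertex decomposable and each facet of $\mathrm{del}_\Delta(v)$ is a facet of $\Delta$ (recursive definition; $\Delta$ is not required to be pure). *)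

(* Defs.v *)
From mathcomp Require Import all_boot.

Set Implicit Arguments.
Unset Strict Implicit.
Unset Printing Implicit Defensive.

(* A finite simple graph is a finType V with a symmetric and irreflexive
   adjacency relation e : rel V. *)

Section Graph.
Variables (V : finType) (e : rel V).

Definition connected_graph : Prop := forall x y : V, connect e x y.

(* The path from x to y is x :: p; paths do not repeat vertices. *)
Definition is_path (x y : V) (p : seq V) : Prop :=
  [/\ path e x p, uniq (x :: p) & last x p = y].

Definition is_tree : Prop :=
  connected_graph /\ forall x y : V, x != y -> exists! p : seq V, is_path x y p.

(* G[A], kept on the vertex type V: vertices outside A have no neighbours. *)
Definition induced (A : {set V}) : rel V :=
  [rel x y | [&& x \in A, y \in A & e x y]].

(* The vertex set of the connected component of x in G[A], for x \in A. *)
Definition induced_component (A : {set V}) (x : V) : {set V} :=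
  [set y in A | connect (induced A) x y].

Definition r_independent (r : nat) (A : {set V}) : bool :=
  [forall x in A, #|induced_component A x| <= r].

Definition Ind (r : nat) : {set {set V}} := [set A | r_independent r A].

End Graph.

(* A complex is the set of its faces: the void complex is set0, and the empty
   complex is [set set0]. *)

Section Complex.
Variable V : finType.
Implicit Types (D : {set {set V}}) (F G : {set V}) (v : V).

Definition simplicial_complex D : Prop :=
  forall F G, G \subset F -> F \in D -> G \in D.

Definition facets D : {set {set V}} := [set F | maxset (mem D) F].

Definition link D v : {set {set V}} :=
  [set F in D | (v \notin F) && (v |: F \in D)].

Definition deletion D v : {set {set V}} := [set F in D | v \notin F].

Definition is_simplex D : Prop := exists F, D = powerset F.

Inductive vertex_decomposable : {set {set V}} -> Prop :=
  | VD_void : vertex_decomposable set0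
  | VD_simplex D : is_simplex D -> vertex_decomposable D
  | VD_shed D v :
      [set v] \in D ->
      vertex_decomposable (link D v) ->
      vertex_decomposable (deletion D v) ->
      facets (deletion D v) \subset facets D ->
      vertex_decomposable D.

Lemma link_complex D v : simplicial_complex D -> simplicial_complex (link D v).
Proof.
move=> cD F G sGF; rewrite !inE => /and3P[FD vF vFD].
rewrite (cD F G) // (contra (subsetP sGF v)) //=.
by apply: cD vFD; apply: setUS.
Qed.

Lemma deletion_complex D v :
  simplicial_complex D -> simplicial_complex (deletion D v).
Proof.
move=> cD F G sGF; rewrite !inE => /andP[FD vF].
by rewrite (cD F G) // (contra (subsetP sGF v)).
Qed.

Lemma is_simplexP D :
  is_simplex D <-> simplicial_complex D /\ exists F, facets D = [set F].
Proof.
split=> [[F ->]|[cD [F fD]]].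
  split=> [A B sBA|]; first by rewrite !inE; apply: subset_trans.
  exists F; apply/setP=> A; rewrite !inE; apply/maxsetP/eqP => [[/= AF mA]|->].
    by apply/esym/mA => /=; rewrite ?inE // -powersetE.
  split=> [|B] /=; first by rewrite inE.
  by rewrite inE => BF FB; apply/eqP; rewrite eqEsubset BF.
have /maxsetP[FD _] : maxset (mem D) F.
  by have := set11 F; rewrite -fD inE.
exists F; apply/setP=> A; rewrite powersetE; apply/idP/idP => [AD|]; last first.
  by move=> sAF; apply: cD sAF FD.
have [B mB sAB] := maxset_exists (P := mem D) AD.
have : B \in facets D by rewrite inE.
by rewrite fD => /set1P <-.
Qed.

End Complex.

Lemma Ind_complex (V : finType) (e : rel V) (r : nat) :
  simplicial_complex (Ind e r).
Proof.
move=> A B sBA; rewrite !inE => /forall_inP hA; apply/forall_inP => x xB.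
apply: leq_trans (hA x (subsetP sBA x xB)); apply: subset_leq_card.
apply/subsetP=> y; rewrite !inE => /andP[yB cxy]; rewrite (subsetP sBA) //=.
apply: connect_sub cxy => u w /and3P[uB wB euw]; apply: connect1.
by apply/and3P; split=> //; apply: (subsetP sBA).
Qed.

(* Main.v *)
Require Import Defs.
From mathcomp Require Import all_boot.

(** Root the tree.  For a set [B] of vertices let [subtree B v] be the set of
    descendants of [v] joined to [v] inside [B]; since every component of the
    graph induced on [B] has a top vertex, [B] is r-independent iff all these
    sets have at most [r] elements.  Iterated links and deletions lead to the
    complexes of all [F] inside [A :\: S] such that [F :|: S] is r-independent,
    where [A] are the vertices not deleted and [S] those already forced in.

    Such a complex is a simplex if no [subtree A v] has more than [r] elements.
    Otherwise take a deepest [v] for which it does.  If [v] is not forced, it is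
    a shedding vertex: a face using [v] misses a vertex of [subtree A v], which
    can replace [v].  If [v] is forced, let [x] be a free child of
    [subtree S v] with [subtree A x] as large as possible.  If a face using [x]
    misses a vertex of [subtree A x], exchange as before; otherwise exchange [x]
    for a missing vertex [z] just below the component of [v], which is possible
    because [subtree A z] is not larger than [subtree A x]. *)

Set Implicit Arguments.
Unset Strict Implicit.
Unset Printing Implicit Defensive.

(** * Descendants in a rooted forest, restricted to a vertex set *)

Section RootedForest.
Variables (V : finType) (par : V -> V) (depth : V -> nat).

(* Roots are the fixed points of [par]. *)
Hypothesis depth_par : forall x, par x != x -> depth (par x) < depth x.

Implicit Types (A B C S F G : {set V}) (v w x y z t : V).

Definition up B : rel V := [rel x y | [&& x \in B, y \in B & par x == y]].

Definition subtree B v : {set V} := [set y in B | connect (up B) y v].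

Lemma subtree_subset B v : subtree B v \subset B.
Proof. by apply/subsetP=> y; rewrite inE => /andP[]. Qed.

Lemma subtree_self B v : v \in B -> v \in subtree B v.
Proof. by move=> vB; rewrite inE vB connect0. Qed.

Lemma subtree_trans B y w v :
  y \in subtree B w -> w \in subtree B v -> y \in subtree B v.
Proof.
rewrite !inE => /andP[-> cyw] /andP[_ cwv]; exact: connect_trans cyw cwv.
Qed.

Lemma subtree_step B y v :
  y \in B -> par y \in subtree B v -> y \in subtree B v.
Proof.
rewrite !inE => yB /andP[pB cpv]; rewrite yB; apply: connect_trans cpv.
by apply: connect1; rewrite /up /= yB pB eqxx.
Qed.

Lemma subtree_ind B v (P : V -> Prop) :
  (v \in B -> P v) ->
  (forall y, y \in B -> par y \in subtree B v -> P (par y) -> P y) ->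
  forall y, y \in subtree B v -> P y.
Proof.
move=> Pv Pstep y; rewrite inE => /andP[yB /connectP[p]].
elim: p y yB => [|x p IHp] y yB /=; first by move=> _ vy; rewrite -vy in yB *; apply: Pv.
case/andP=> /and3P[_ xB /eqP yx] xp vx; apply: Pstep => //; rewrite yx; last exact: IHp xp vx.
by rewrite inE xB; apply/connectP; exists p.
Qed.

Lemma subtree_top B y v : y \in subtree B v -> v \in B.
Proof. by elim/subtree_ind. Qed.

Lemma subtree_par B y v :
  y \in subtree B v -> y != v -> par y \in subtree B v.
Proof. by elim/subtree_ind => [_|//]; rewrite eqxx. Qed.

Lemma subtreeS A B v : A \subset B -> subtree A v \subset subtree B v.
Proof.
move=> sAB; apply/subsetP=> y; elim/subtree_ind=> [vA|{}y yA _ pB].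
  exact/subtree_self/(subsetP sAB).
exact: subtree_step (subsetP sAB _ yA) pB.
Qed.

Lemma subtree_depth B y v : y \in subtree B v -> y != v -> depth v < depth y.
Proof.
elim/subtree_ind=> [_|{}y yB pv IH yv]; first by rewrite eqxx.
have [py|py] := eqVneq (par y) y; first by move: IH; rewrite py; apply.
have [<-|pyv] := eqVneq (par y) v; first exact: depth_par.
exact: ltn_trans (IH pyv) (depth_par py).
Qed.

Lemma subtree_antisym A B x y : x \in subtree A y -> y \in subtree B x -> x = y.
Proof.
move=> xy yx; apply/eqP/negPn/negP=> nxy.
have := ltn_trans (subtree_depth xy nxy) (subtree_depth yx _).
by rewrite ltnn eq_sym => /(_ nxy).
Qed.

(** Both climbs from [z] follow the same map [par], so the end reached first lies on the other
    climb; this works even though they stay in different sets. *)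
Lemma subtree_comparable A B z v w :
  z \in subtree A v -> z \in subtree B w ->
  w \in subtree A v \/ v \in subtree B w.
Proof.
elim/subtree_ind=> [_ |{}z zA pv IH zw]; first by right.
have [<-|nzw] := eqVneq z w; first by left; apply: subtree_step.
exact: IH (subtree_par zw nzw).
Qed.

Lemma subtree_avoid B z y v :
  y \in subtree B v ->
  y \in subtree (B :\ z) v \/ y \in subtree B z /\ z \in subtree B v.
Proof.
elim/subtree_ind=> [vB|{}y yB pv IH].
  have [<-|vz] := eqVneq v z; last by left; rewrite subtree_self // !inE vz.
  by right; rewrite subtree_self.
have [<-|yz] := eqVneq y z.
  by right; rewrite subtree_self // subtree_step.
case: IH => [pvz|[pz zv]]; last by right; rewrite subtree_step.
by left; apply: subtree_step => //; rewrite !inE yz.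
Qed.

(** [t] is the last vertex before the climb from [y] to [v] first enters [C]. *)
Lemma subtree_crossing A C y v :
  y \in subtree A v -> v \in C -> y \notin C ->
  exists t, [/\ y \in subtree A t, t \in subtree A v, t \notin C & par t \in C].
Proof.
move=> + vC; elim/subtree_ind=> [_|{}y yA pv IH yC]; first by rewrite vC.
have [pC|pC] := boolP (par y \in C).
  by exists y; rewrite subtree_self // subtree_step.
by have [t [pt tv tC ptC]] := IH pC; exists t; rewrite subtree_step.
Qed.

(** * Small subtrees and exchange of vertices *)

Variable r : nat.

Definition small_subtrees B : bool := [forall v, #|subtree B v| <= r].

Lemma small_subtreesS A B :
  A \subset B -> small_subtrees B -> small_subtrees A.
Proof.
move=> sAB /forallP sB; apply/forallP=> v.
exact: leq_trans (subset_leq_card (subtreeS v sAB)) (sB v).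
Qed.

(** Only subtrees that contain the new vertex [z] can have grown; any other one lies inside a
    subtree of [B]. *)
Lemma small_subtrees_exchange B x z :
  small_subtrees B ->
  (forall w, z \in subtree (z |: B :\ x) w -> #|subtree (z |: B :\ x) w| <= r) ->
  small_subtrees (z |: B :\ x).
Proof.
move=> /forallP sB sz; apply/forallP=> w; set B' := z |: _.
have [/sz//|zw] := boolP (z \in subtree B' w).
apply: leq_trans (sB w); apply/subset_leq_card/subsetP=> t tw.
have [tw'|[_]] := subtree_avoid z tw; last by rewrite (negPf zw).
apply: subsetP tw'; apply: subtreeS; apply/subsetP=> u; rewrite !inE.
by case: (u == z) => //= /andP[].
Qed.

(** The shedding condition at [x], phrased for sets [B] that consist of a face and the forced
    vertices. *)
Definition exchangeable A S x : Prop :=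
  forall B, S \subset B -> B \subset A -> x \in B -> small_subtrees B ->
  exists z, [/\ z \in A, z \notin B & small_subtrees (z |: B :\ x)].

(** Once [x] is removed, a climb from [z] stops strictly below [x], where even the subtrees of [A]
    are small. *)
Lemma exchange_below A B x z :
  (forall w, w \in subtree A x -> w != x -> #|subtree A w| <= r) ->
  B \subset A -> x \in B -> small_subtrees B ->
  z \in subtree A x -> z \notin B -> small_subtrees (z |: B :\ x).
Proof.
move=> sA sBA xB sB zx zB; apply: small_subtrees_exchange => // w zw.
have zA := subsetP (subtree_subset _ _) _ zx.
have xz : x != z by apply: contraNneq zB => <-.
have sB'A : z |: B :\ x \subset A.
  by rewrite subUset sub1set zA (subset_trans (subsetDl _ _)).
have xB' : x \notin z |: B :\ x by rewrite !inE eqxx (negPf xz).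
have [wx|xw] := subtree_comparable zx zw; last first.
  by rewrite (subsetP (subtree_subset _ _) _ xw) in xB'.
have wx' : w != x by apply: contraNneq xB' => wx'; move: (subtree_top zw); rewrite wx'.
exact: leq_trans (subset_leq_card (subtreeS w sB'A)) (sA w wx wx').
Qed.

Lemma subtree_restrict A B v :
  subtree A v \subset B -> subtree A v \subset subtree B v.
Proof.
move=> sub; apply/subsetP=> y yv; have yB := subsetP sub _ yv.
move: yv yB; elim/subtree_ind=> [_|{}y yA pv IH yB]; first exact: subtree_self.
by apply: subtree_step => //; apply: IH (subsetP sub _ pv).
Qed.

Lemma exchange_free_top A S v :
  (forall w, w \in subtree A v -> w != v -> #|subtree A w| <= r) ->
  r < #|subtree A v| -> exchangeable A S v.
Proof.
move=> sA bigv B _ sBA vB sB.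
have /subsetPn[z zv zB] : ~~ (subtree A v \subset B).
  apply: contraL bigv => sub; rewrite -leqNgt.
  exact: leq_trans (subset_leq_card (subtree_restrict sub)) (forallP sB v).
exists z; split=> //; first exact: subsetP (subtree_subset _ _) _ zv.
exact: exchange_below zv zB.
Qed.

(** In the main case [B] contains all of [subtree A x]. Removing [x] cuts this whole set off from
    above, which makes room for whatever [z] brings in. *)
Lemma exchange_forced_top A S v x :
  (forall w, w \in subtree A v -> w != v -> #|subtree A w| <= r) ->
  r < #|subtree A v| -> S \subset A -> v \in S ->
  x \in A -> x \notin S -> par x \in subtree S v ->
  (forall y, y \in A -> y \notin S -> par y \in subtree S v ->
     #|subtree A y| <= #|subtree A x|) ->
  exchangeable A S x.
Proof.
move=> sA bigv sSA vS xA xS pxS maxx B sSB sBA xB sB.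
have xv : x \in subtree A v.
  by apply: subtree_step => //; apply: (subsetP (subtreeS v sSA)).
have x_neq_v : x != v by apply: contraNneq xS => ->.
have [sub|/subsetPn[z zx zB]] := boolP (subtree A x \subset B); last first.
  exists z; split=> //; first exact: subsetP (subtree_subset _ _) _ zx.
  apply: (exchange_below (A := A)) => // w wx wx'.
  apply: sA; first exact: subtree_trans wx xv.
  by apply: contraNneq wx' => wv; rewrite wv in wx *; rewrite (subtree_antisym wx xv).
have /subsetPn[z0 z0v z0B] : ~~ (subtree A v \subset subtree B v).
  apply: contraL bigv => /subset_leq_card le; rewrite -leqNgt.
  exact: leq_trans le (forallP sB v).
have vB := subsetP sSB _ vS.
have [z [_ zv zBv pzB]] := subtree_crossing z0v (subtree_self vB) z0B.
have zA := subsetP (subtree_subset _ _) _ zv.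
have zB : z \notin B by apply: contra zBv => zB; apply: subtree_step.
exists z; split=> //; apply: small_subtrees_exchange => // w zw.
set B' := z |: B :\ x in zw *.
have xz : x != z by apply: contraNneq zB => <-.
have xB' : x \notin B' by rewrite !inE eqxx (negPf xz).
have sB'A : B' \subset A.
  by rewrite subUset sub1set zA (subset_trans (subsetDl _ _)).
have sB'B : B' :\ z \subset B.
  by apply/subsetP=> u; rewrite !inE; case: (u == z) => //= /andP[].
have vB' : v \in B' by rewrite !inE vB [v == x]eq_sym x_neq_v orbT.
(* Either [w] is strictly below [v], where subtrees of [A] are small, or [w] is [v] or an ancestor
   of it within [B']. *)
have [/andP[wv wv']|vw] :
    (w \in subtree A v) && (w != v) \/ v \in subtree B' w.
- have [->|wv'] := eqVneq w v; first by right; apply: subtree_self.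
  by have [->|->] := subtree_comparable zv zw; [left | right].
- exact: leq_trans (subset_leq_card (subtreeS w sB'A)) (sA w wv wv').
have vBw : v \in subtree B w.
  have [vw'|[vz _]] := subtree_avoid z vw; first exact: subsetP (subtreeS w sB'B) _ vw'.
  by case/negP: zB; rewrite (subtree_antisym zv vz).
have xBw : x \in subtree B w.
  apply: subtree_trans vBw; apply: subtree_step => //.
  exact: subsetP (subtreeS v sSB) _ pxS.
have xsub : subtree A x \subset subtree B w.
  apply: subset_trans (subtree_restrict sub) _.
  by apply/subsetP=> t tx; apply: subtree_trans tx xBw.
(* The maximality of [x] concerns children of [subtree S v], and [z] may lie deeper; it is compared
   through its ancestor [t], which is such a child. *)
have zlex : #|subtree A z| <= #|subtree A x|.
  have zS : z \notin subtree S v.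
    apply: contra zB => zS; apply: (subsetP sSB).
    exact: subsetP (subtree_subset _ _) _ zS.
  have [t [zt tv tS ptS]] := subtree_crossing zv (subtree_self vS) zS.
  apply: (@leq_trans #|subtree A t|).
    by apply/subset_leq_card/subsetP=> u uz; apply: subtree_trans uz zt.
  apply: maxx => //; first exact: subsetP (subtree_subset _ _) _ tv.
  by apply: contra tS => tS; apply: subtree_step.
(* A climb to [w] from within [subtree A x] would pass through [x], which is not in [B']. *)
have B'sub : subtree B' w \subset (subtree B w :\: subtree A x) :|: subtree A z.
  apply/subsetP=> t tw; rewrite !in_setU in_setD.
  have [tw'|[tz _]] := subtree_avoid z tw; last first.
    by rewrite (subsetP (subtreeS z sB'A) _ tz) orbT.
  rewrite (subsetP (subtreeS w sB'B) _ tw') andbT.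
  have [tx|//] := boolP (t \in subtree A x).
  have [wx|xw] := subtree_comparable tx tw; last first.
    by rewrite (subsetP (subtree_subset _ _) _ xw) in xB'.
  by case/negP: xB'; rewrite (subtree_antisym xBw wx) (subtree_top tw).
apply: leq_trans (forallP sB w); apply: leq_trans (subset_leq_card B'sub) _.
apply: leq_trans (leq_card_setU _ _) _.
by rewrite cardsD (setIidPr xsub) addnBAC ?subset_leq_card // leq_subLR addnC leq_add2r.
Qed.

Lemma exists_exchangeable A S :
  S \subset A -> small_subtrees S -> ~~ small_subtrees A ->
  exists2 x, x \in A :\: S & exchangeable A S x.
Proof.
move=> sSA sS; rewrite negb_forall => /existsP[v0]; rewrite -ltnNge => big0.
case: (@arg_maxnP _ v0 (fun v => r < #|subtree A v|) depth big0) => v bigv maxv.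
have sA w : w \in subtree A v -> w != v -> #|subtree A w| <= r.
  move=> wv wv'; rewrite leqNgt; apply/negP=> /maxv.
  by rewrite /= leqNgt (subtree_depth wv).
have vA : v \in A.
  case/card_gt0P: (leq_ltn_trans (leq0n r) bigv) => y; exact: subtree_top.
have [vS|vS] := boolP (v \in S); last first.
  by exists v; [rewrite inE vS | apply: exchange_free_top].
(* [subtree S v] is small and [subtree A v] is not, so some climb to [v] enters [subtree S v] from a
   free child. *)
have /subsetPn[z0 z0v z0S] : ~~ (subtree A v \subset subtree S v).
  apply: contraL bigv => /subset_leq_card le; rewrite -leqNgt.
  exact: leq_trans le (forallP sS v).
have [t [_ tv tSv ptS]] := subtree_crossing z0v (subtree_self vS) z0S.
pose free_child y := (y \in A :\: S) && (par y \in subtree S v).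
have ft : free_child t.
  rewrite /free_child ptS inE (subsetP (subtree_subset _ _) _ tv) !andbT.
  by apply: contra tSv => tS; apply: subtree_step.
case: (@arg_maxnP _ t free_child (fun y => #|subtree A y|) ft) => x.
case/andP=> xAS pxS maxx; exists x => //; case/setDP: xAS => xA xS.
apply: (@exchange_forced_top A S v) => // y yA yS pyS.
by apply: maxx; rewrite /free_child inE yS yA.
Qed.

(** * Complexes with deleted and forced vertices, and their vertex decomposability *)

Definition forced_complex A S : {set {set V}} :=
  [set F : {set V} | (F \subset A :\: S) && small_subtrees (F :|: S)].

Lemma link_forced_complex A S x : x \in A :\: S ->
  link (forced_complex A S) x = forced_complex A (x |: S).
Proof.
move=> xAS; apply/setP=> F; rewrite !inE [x |: S]setUC -setDDl subsetD1.
rewrite subUset sub1set xAS (setUC S) setUCA -setUA /=.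
case: (F \subset _); case: (x \notin F); rewrite ?andbF //= andb_idl //.
by apply: small_subtreesS; apply: subsetUr.
Qed.

Lemma deletion_forced_complex A S x :
  deletion (forced_complex A S) x = forced_complex (A :\ x) S.
Proof.
apply/setP=> F; rewrite !inE setDDl [[set x] :|: S]setUC -setDDl subsetD1.
by rewrite -!andbA; congr (_ && _); rewrite andbC.
Qed.

(** If a face [G] containing [x] extends a facet [F] of the deletion, exchange [x] for [z] in [G].
    Then [z |: F] is a face avoiding [x], so maximality puts [z] in [F] and hence in [G], a
    contradiction. *)
Lemma facets_deletion_forced_complex A S x :
  S \subset A -> x \in A :\: S -> exchangeable A S x ->
  facets (deletion (forced_complex A S) x) \subset facets (forced_complex A S).
Proof.
move=> sSA xAS exch; apply/subsetP=> F; rewrite !inE => /maxsetP[/=].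
rewrite [_ \in _]inE => /andP[FD xF] maxF.
apply/maxsetP; split=> //= G GD sFG.
have [xG|xG] := boolP (x \in G); last by apply: maxF; rewrite //= inE GD.
move: (GD); rewrite inE => /andP[sGAS smallG].
have [||||z [zA zG smallz]] := exch (G :|: S) => //.
- exact: subsetUr.
- by rewrite subUset sSA (subset_trans sGAS) ?subsetDl.
- by rewrite inE xG.
move: zG; rewrite inE negb_or => /andP[zG zS]; case/setDP: xAS => xA xS.
have FzE : z |: F = F.
  apply: maxF; last exact: subsetUr.
  rewrite /= !inE negb_or xF andbT; apply/andP; split; last first.
    by apply: contraNneq zG => <-.
  rewrite subUset sub1set inE zA zS (subset_trans sFG sGAS) /=.
  apply: small_subtreesS smallz; rewrite -setUA setUS // subsetD1.
  by rewrite inE negb_or xF xS setSU.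
by case/negP: zG; apply: (subsetP sFG); rewrite -FzE setU11.
Qed.

Lemma forced_complex_vertex_decomposable A S :
  S \subset A -> vertex_decomposable (forced_complex A S).
Proof.
have [n] := ubnP #|A :\: S|; elim: n => // n IHn in A S * => leAS sSA.
have [sS|bigS] := boolP (small_subtrees S); last first.
  rewrite (_ : forced_complex A S = set0); first exact: VD_void.
  apply/setP=> F; rewrite !inE; apply/negP=> /andP[_].
  by apply/negP; apply: contra bigS; apply: small_subtreesS; apply: subsetUr.
have [sA|bigA] := boolP (small_subtrees A).
  apply: VD_simplex; exists (A :\: S); apply/setP=> F; rewrite !inE.
  rewrite andb_idr // => sF; apply: small_subtreesS sA.
  by rewrite subUset sSA (subset_trans sF) ?subsetDl.
have [x xAS exch] := exists_exchangeable sSA sS bigA.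
have [xA xS] := setDP xAS.
have ltA : #|(A :\: S) :\ x| < n by move: leAS; rewrite (cardsD1 x) xAS.
have VDdel : vertex_decomposable (deletion (forced_complex A S) x).
  rewrite deletion_forced_complex; apply: IHn.
    by rewrite setDDl [[set x] :|: S]setUC -setDDl.
  by rewrite subsetD1 sSA.
(* Shedding requires [x] to be a vertex of the complex; if it is not, no face contains it and the
   complex equals its deletion. *)
have [xD|xD] := boolP ([set x] \in forced_complex A S).
  apply: VD_shed xD _ VDdel _; last exact: facets_deletion_forced_complex.
  rewrite link_forced_complex //; apply: IHn; last by rewrite subUset sub1set xA.
  by rewrite [x |: S]setUC -setDDl.
rewrite (_ : forced_complex A S = deletion (forced_complex A S) x) //.
apply/setP=> F; rewrite [in RHS]inE andb_idr // !inE => /andP[sF sFS].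
apply: contra xD => xF; rewrite inE sub1set xAS /=.
by apply: small_subtreesS sFS; rewrite setSU // sub1set.
Qed.

(** * From small subtrees to r-independence *)

Variable e : rel V.
Hypothesis e_par : forall x y, e x y = (x != y) && ((par x == y) || (par y == x)).

Lemma r_independent_small_subtrees B : r_independent e r B = small_subtrees B.
Proof.
apply/forall_inP/forallP => [indB v|sB x xB].
  have [vB|vB] := boolP (v \in B); last first.
    rewrite (_ : subtree B v = set0) ?cards0 //; apply/setP=> y; rewrite in_set0.
    by apply: contraNF vB; apply: subtree_top.
  apply: leq_trans (indB v vB); apply/subset_leq_card/subsetP=> y.
  elim/subtree_ind=> [_|{}y yB pv]; first by rewrite inE vB connect0.
  rewrite !inE yB => /andP[pB cvp]; apply: (connect_trans cvp).
  have [->|npy] := eqVneq (par y) y; first exact: connect0.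
  by apply: connect1; rewrite /induced /= pB yB e_par npy eqxx orbT.
(* [t] is the shallowest vertex reached by climbing from [x] inside [B]: the top of its
   component. *)
case: (@arg_minnP _ x (fun t => x \in subtree B t) depth (subtree_self xB)).
move=> t xt mint; have tB := subtree_top xt.
have top_t : par t \in B -> par t = t.
  move=> pB; apply/eqP/negPn/negP=> /depth_par; apply/negP; rewrite -leqNgt.
  apply: mint; apply: subtree_trans xt _.
  by apply: subtree_step => //; apply: subtree_self.
apply: leq_trans (sB t); apply/subset_leq_card/subsetP=> y.
rewrite inE => /andP[_ /connectP[p]].
(* No edge inside [B] leaves [subtree B t]: a downward edge stays in it, and no upward edge starts
   at [t]. *)
elim: p x xt {xB mint} => [|z p IHp] x xt /= => [_ -> //|/andP[xz zp] yz].
apply: IHp zp yz; case/and3P: xz => _ zB; rewrite e_par => /andP[nxz].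
case/orP=> /eqP pz; last by apply: subtree_step; rewrite ?pz.
have [xEt|xt'] := eqVneq x t; last by rewrite -pz subtree_par.
by rewrite xEt in pz nxz; case/eqP: nxz; rewrite -pz top_t // pz.
Qed.

Lemma Ind_vertex_decomposable : vertex_decomposable (Ind e r).
Proof.
rewrite (_ : Ind e r = forced_complex setT set0).
  exact/forced_complex_vertex_decomposable/sub0set.
by apply/setP=> F; rewrite !inE setD0 subsetT setU0 r_independent_small_subtrees.
Qed.

End RootedForest.

(** * Rooting a tree *)

Section RootedTree.
Variables (V : finType) (e : rel V).
Hypotheses (e_sym : symmetric e) (e_irr : irreflexive e) (e_tree : is_tree e).

(** The definition of a tree covers distinct endpoints; for equal ones, absence of repetition forces
    the empty path. *)
Lemma tree_path_unique x y p q : is_path e x y p -> is_path e x y q -> p = q.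
Proof.
have [xy|/(proj2 e_tree)[s [_ us]] pP qP] := eqVneq x y; last first.
  by rewrite -(us _ pP) -(us _ qP).
have nilP s : is_path e x y s -> s = [::].
  case: s => // z s [_ /= /andP[/negP xs _] zy]; case: xs.
  by rewrite xy -zy mem_last.
by move=> /nilP-> /nilP->.
Qed.

(** The parent is the next vertex on the unique path to the root, and the depth is the length of
    that path. *)
Lemma tree_rooting (root : V) : exists (par : V -> V) (depth : V -> nat),
  (forall x, par x != x -> depth (par x) < depth x) /\
  (forall x y, e x y = (x != y) && ((par x == y) || (par y == x))).
Proof.
have exP x : exists p, [&& path e x p, uniq (x :: p) & last x p == root].
  have /connectP[p pP pl] := proj1 e_tree x root.
  case/shortenP: pP pl => q qP qU _ ql.
  by exists q; rewrite qP qU ql eqxx.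
pose P x := xchoose (exP x).
have PP x : is_path e x root (P x).
  by have /and3P[pP pU /eqP pl] := xchooseP (exP x).
(* The default value [x] makes the root a fixed point. *)
pose par x := head x (P x).
have path_cons x y p : P x = y :: p -> [/\ e x y, P y = p & x != y].
  move=> Px; have := PP x; rewrite Px => -[/= /andP[xy yp] /andP[xp up] pl].
  split=> //; first exact: tree_path_unique (PP y) _.
  by apply: contraTneq xy => ->; rewrite e_irr.
exists par, (size \o P); split=> [x|x y].
  rewrite /par /=; case E: (P x) => [|y p] /=; first by rewrite eqxx.
  by have [_ -> _] := path_cons _ _ _ E.
have e_head u : par u != u -> e u (par u).
  rewrite /par; case E: (P u) => [|w p] /=; first by rewrite eqxx.
  by have [] := path_cons _ _ _ E.
apply/idP/andP=> [exy|[nxy /orP[]/eqP pE]]; last first.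
- by rewrite -pE e_sym e_head // pE.
- by rewrite -pE e_head // pE eq_sym.
have nxy : x != y by apply: contraTneq exy => ->; rewrite e_irr.
split=> //; have [yp yu yl] := PP y.
(* If the path from [y] to the root avoids [x], the one from [x] starts with the step to [y].
   Otherwise the edge from [y] to [x] shortcuts it, and uniqueness makes [x] its first step. *)
have [xy|xy] := boolP (x \in y :: P y); last first.
  rewrite /par (_ : P x = y :: P y) ?eqxx //.
  by apply: tree_path_unique (PP x) _; split; rewrite //= ?exy // xy.
move: xy; rewrite inE (negPf nxy) /= => xy; apply/orP; right.
case/splitPr E: {1}(P y) / xy => [p1 p2].
move: yp yu yl; rewrite E cat_path last_cat /= mem_cat cat_uniq /= inE !negb_or.
case/and3P=> _ _ xp2 /and3P[/and3P[_ yx yp2] _ /and3P[_ xNp2 up2]] yl.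
rewrite /par (_ : P y = x :: p2) //=.
apply: tree_path_unique (PP y) _; split=> //=; first by rewrite e_sym exy.
by rewrite inE negb_or yx yp2 xNp2.
Qed.

End RootedTree.

Theorem theorem1p1 (V : finType) (e : rel V) (e_sym : symmetric e)
    (e_irr : irreflexive e) (e_tree : is_tree e) (r : nat) (r_ge1 : 1 <= r) :
  vertex_decomposable (Ind e r).
Proof.
have [root _|V0] := pickP V.
  have [par [depth [depth_par e_par]]] := tree_rooting e_sym e_irr e_tree root.
  exact: (Ind_vertex_decomposable depth_par r e_par).
(* With no vertex to serve as root, any parent and depth maps will do. *)
apply: (@Ind_vertex_decomposable _ id (fun=> 0)) => [x|x y]; first by rewrite eqxx.
by have := V0 x.
Qed.
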